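(* Let $B^d=\{x\in\mathbb{R}^d : \sum_{j=1}^d x_j^2\le 1\}$ be the closed $d$-dimensional Euclidean unit ball and let $f(B^d)$ be the constant defined in the context. Then $$f(B^d)=O(2.447^{-d})\qquad (d\to\infty),$$ that is, there is an absolute constant $C>0$ such that $f(B^d)\le C\cdot 2.447^{-d}$ for every integer $d\ge 1$.
   Context: For a set $E\subseteq\mathbb{R}^d$, $|E|$ denotes its $d$-dimensional volume (Lebesgue measure). For a symmetric convex body $K\subseteq\mathbb{R}^d$ (compact, convex, non-empty interior, centrally symmetric about the origin), $f(K)$ denotes the largest constant $c\ge 0$ such that: every finite collection $\mathcal{C}$ of congruent homothetic copies of $K$ (i.e. $\mathcal{C}=\{x_1+rK,\dots,x_N+rK\}$ with $x_1,\dots,x_N\in\mathbb{R}^d$ and a common $r>0$) admits a sub-collection $\mathcal{S}\subseteq\mathcal{C}$ of pairwise disjoint sets with $|\bigcup_{K'\in\mathcal{S}}K'|\ge c\,|\bigcup_{K'\in\mathcal{C}}K'|$. By scaling one may equivalently take $r=1$. *)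

(* Defs.v *)
From mathcomp Require Import all_boot all_order all_algebra.
From mathcomp Require Import all_classical all_reals all_analysis.

Set Implicit Arguments.
Unset Strict Implicit.
Unset Printing Implicit Defensive.

Import Order.TTheory GRing.Theory Num.Theory.

Local Open Scope classical_set_scope.
Local Open Scope ring_scope.

Definition box (R : realType) (d : nat) (a b : 'rV[R]_d) : set 'rV[R]_d :=
  [set x | forall i, a 0 i <= x 0 i <= b 0 i].

Definition box_volume (R : realType) (d : nat) (a b : 'rV[R]_d) : R :=
  \prod_(i < d) (b 0 i - a 0 i).

(* The d-dimensional Lebesgue outer measure, for d >= 1: the infimum of the
   total volumes of countable covers by boxes. It coincides with Lebesgue
   measure on Lebesgue measurable sets, in particular on finite unions of
   compact sets. (At d = 0 no box is empty, so every set gets +oo.) *)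
Definition volume (R : realType) (d : nat) (A : set 'rV[R]_d) : \bar R :=
  ereal_inf [set v : \bar R | exists a b : nat -> 'rV[R]_d,
    [/\ forall k i, a k 0 i <= b k 0 i,
        A `<=` \bigcup_k box (a k) (b k)
      & v = (\sum_(0 <= k <oo) (box_volume (a k) (b k))%:E)%E]].

Definition homothetic_copy (R : realType) (d : nat)
    (x : 'rV[R]_d) (r : R) (K : set 'rV[R]_d) : set 'rV[R]_d :=
  [set x + r *: y | y in K].

Definition congruent_copies (R : realType) (d : nat) (K : set 'rV[R]_d)
    (C : set (set 'rV[R]_d)) : Prop :=
  finite_set C /\ exists r : R, 0 < r /\
    forall K', C K' -> exists x, K' = homothetic_copy x r K.

Definition disjoint_selection_const (R : realType) (d : nat)
    (K : set 'rV[R]_d) (c : R) : Prop :=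
  forall C : set (set 'rV[R]_d), congruent_copies K C ->
  exists S : set (set 'rV[R]_d),
    [/\ S `<=` C,
        trivIset S id
      & (c%:E * volume (\bigcup_(K' in C) K')
           <= volume (\bigcup_(K' in S) K'))%E].

(* The supremum is taken in \bar R because sup on R takes the value 0 on sets
   that are not bounded above. It is a maximum when K is a convex body: a
   collection C has finitely many sub-collections, so the inequality passes to
   the limit in c. *)
Definition selection_const (R : realType) (d : nat) (K : set 'rV[R]_d) :
    \bar R :=
  ereal_sup [set c%:E | c in
    [set c : R | 0 <= c /\ disjoint_selection_const K c]].

Definition unit_ball (R : realType) (d : nat) : set 'rV[R]_d :=
  [set x | \sum_(j < d) x 0 j ^+ 2 <= 1].
Arguments unit_ball : clear implicits.

(* Main.v *)
Require Import Defs.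
From mathcomp Require Import all_boot all_order all_algebra.
From mathcomp Require Import all_classical all_reals all_analysis.
From mathcomp Require Import measurable_realfun.
From mathcomp Require Import ring lra zify.

(** Take unit balls centred at a fine net of the ball of radius rho.  All of
    them together fill a ball of radius almost 1 + rho, while a disjoint
    subfamily has at most A members, where A is the largest number of points of
    the ball of radius rho with mutual distances larger than 2.  Hence
    f(B^d) <= A / (1 + rho) ^ d ([selection_le_packing]).  For rho = sqrt 2 the
    number A is linear in d, which gives the rate 1 + sqrt 2 = 2.414; the rate
    2.447 needs a larger radius, here rho ^ 2 = 2.2626 with balls that fill
    radius 2.504, and a sharp bound for A ([separated_points_card_le]).

    Lifting the points to a sphere of R^n, n = d + 1, only increases distances,
    so A is bounded by the size of a spherical code.  With the sphere scaled so
    that |x| ^ 2 = n, the inner products t of distinct code points are at most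
    s = 0.1161 n, and the bound is that of Kabatiansky and Levenshtein
    ([spherical_code_card_le]).  Suppose that a zonal kernel g has a Gram
    representation with nonnegative weights on D features, and that
    (t - L) g is such a Gram kernel as well, with L > s.  The entrywise product
    of two Gram kernels has nonnegative entry sum, so the sum over all pairs of
    (t - L) g ^ 2, each point weighted by 1 / g(x, x), is at least 0; the pairs
    of distinct points contribute at most (s - L) g ^ 2.  Since g has D
    features, Cauchy-Schwarz bounds the weighted sum of g ^ 2 below by
    (#|I|) ^ 2 / D.  Together, #|I| <= D (n - s) / (L - s).

    The kernels come from Hermite polynomials rather than from Gegenbauer
    polynomials, which makes the Gram representation visible.  The kernel
    E_j(x, y), the sum over multi-indices of degree j of the products of the
    normalised Hermite features at x and y, is the coefficient of r ^ j in a
    product over the coordinates of one-variable Mehler series.  Each factor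
    satisfies a first-order linear differential equation in r, hence so does the
    product, and on the sphere the equation involves x and y only through
    t = <x, y>.  For Q_j = E_j + E_(j-2) it reads
      t Q_j = (j + 1) Q_(j+1) + (n - 3 j + 1) Q_(j-1) + 4 (j - 1) E_(j-3)
    ([zonal_rec]).  The last term has the good sign, so g = sum_j c_j Q_j works
    as soon as c is a subsolution of a three-term recurrence
    ([psd_test_kernel_mul]); a slowly varying bump times the geometric sequence
    17 ^ - j, supported just below k = n / 292, is one
    ([window_coef_eigen]).  Then D is the number of monomials of degree less
    than k in n variables, at most (2504 / 2447) ^ n
    ([multidegree_card_le_rate]), and 2504 ^ d cancels in the quotient. *)

Set Implicit Arguments.
Unset Strict Implicit.
Unset Printing Implicit Defensive.

Import Order.TTheory GRing.Theory Num.Theory.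

Local Open Scope ring_scope.

(** * Hermite polynomials and the Mehler kernel *)

Section Mehler.
Context {R : realFieldType}.
Implicit Types (x y : R) (T : nat).

Fixpoint hermite (a : nat) x : R :=
  if a is a1.+1 then
    if a1 is a2.+1 then x * hermite a1 x - a1%:R * hermite a2 x else x
  else 1.

Lemma hermiteSS a x :
  hermite a.+2 x = x * hermite a.+1 x - a.+1%:R * hermite a x.
Proof. by []. Qed.

Definition mehler_coef a x y : R := hermite a x * hermite a y / a`!%:R.

(** The series in r whose coefficients are [mehler_coef] sums to
    (1 - r^2)^(-1/2) exp ((2 r x y - r^2 (x^2 + y^2)) / (2 (1 - r^2))) by
    Mehler's formula; polynomials truncated at degree [T] stand for it. *)
Definition mehler_poly T x y : {poly R} := \poly_(a < T.+1) mehler_coef a x y.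

(** (1 - r^2)^2 times the logarithmic derivative of Mehler's closed form. *)
Definition mehler_factor x y : {poly R} :=
  'X * (1 - 'X^2) + (x * y)%:P * (1 + 'X^2) - (x ^+ 2 + y ^+ 2)%:P * 'X.

(** The differential equation of the Mehler series, read off at degree a + 3.
    Both sides reduce to polynomials in the Hermite values of degrees a and
    a + 1. *)
Lemma mehler_coef_rec a x y :
  a.+4%:R * mehler_coef a.+4 x y - 2 * a.+2%:R * mehler_coef a.+2 x y
    + a%:R * mehler_coef a x y
  = mehler_coef a.+2 x y - mehler_coef a x y
    + x * y * (mehler_coef a.+3 x y + mehler_coef a.+1 x y)
    - (x ^+ 2 + y ^+ 2) * mehler_coef a.+2 x y.
Proof.
rewrite /mehler_coef !hermiteSS.
move: (hermite a x) (hermite a y) (hermite a.+1 x) (hermite a.+1 y).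
move=> p q p1 q1.
rewrite !factS !natrM.
have := pnatr_eq0 R a`!; rewrite (gtn_eqF (fact_gt0 a)).
move: (a`!%:R : R) => f /negbT f0.
have a0 : (0 : R) <= a%:R by [].
rewrite -[a.+4]addn4 -[a.+3]addn3 -[a.+2]addn2 -[a.+1]addn1 !natrD.
move: (a%:R : R) a0 => b b0.
field.
by rewrite f0 /=; apply/and4P; split; rewrite gt_eqF //; lra.
Qed.

(** Truncation only perturbs the differential equation from degree [T] on. *)
Lemma mehler_poly_ode T x y : exists J : {poly R},
  (1 - 'X^2) ^+ 2 * (mehler_poly T x y)^`()
  = mehler_factor x y * mehler_poly T x y + 'X^T * J.
Proof.
set p := mehler_poly T x y.
pose D := (1 - 'X^2) ^+ 2 * p^`() - mehler_factor x y * p.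
suff D0 : take_poly T D = 0.
  exists (drop_poly T D).
  have DE : D = 'X^T * drop_poly T D.
    by rewrite -{1}(poly_take_drop T D) D0 add0r mulrC.
  by rewrite -DE /D [RHS]addrC subrK.
apply/polyP => i; rewrite coef_take_poly coef0; case: ltnP => // iT.
have -> : D = p^`() - 'X^2 * p^`() *+ 2 + 'X^4 * p^`()
  - ('X * p - 'X^3 * p + (x * y)%:P * p + (x * y)%:P * ('X^2 * p)
      - (x ^+ 2 + y ^+ 2)%:P * ('X * p)).
  by rewrite /D /mehler_factor; ring.
have pc j : (j <= T)%N -> p`_j = mehler_coef j x y.
  by move=> jT; rewrite coef_poly ltnS jT.
rewrite !(coefD, coefB, coefN, coefMn, coefCM, coefXnM, coefXM, coef_deriv).
case: i iT => [|[|[|i]]] iT /=; rewrite ?subn0 ?pc //; try lia;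
  rewrite -?[_ *+ _ in RHS]mulr_natl.
- by rewrite /mehler_coef /= !fact0 (_ : 1`! = 1)%N // !divr1; ring.
- rewrite /mehler_coef /= (_ : 2`! = 2)%N // (_ : 1`! = 1)%N // fact0.
  by field.
- rewrite /mehler_coef /= (_ : 3`! = 6)%N // (_ : 2`! = 2)%N // (_ : 1`! = 1)%N //.
  by rewrite subnn fact0; field.
have /eqP := mehler_coef_rec i x y.
rewrite -subr_eq0 => /eqP rec0.
case: i iT rec0 => [|i] iT rec0 /=; rewrite ?subSS ?subn0 ?pc //; try lia;
  rewrite -[RHS]rec0;
  by ring.
Qed.
End Mehler.

(** * Zonal kernels on the sphere *)

Section Kernels.
Context {R : realFieldType} {n : nat}.
Implicit Types (x y : 'I_n -> R) (T : nat).

(** The coefficient of degree j collects the Hermite features of multidegree j,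
    see [coef_mehler_prod]. *)
Definition mehler_prod T x y : {poly R} :=
  \prod_(m < n) mehler_poly T (x m) (y m).

(** Logarithmic derivatives add up under products. *)
Lemma mehler_prod_ode T x y : exists J : {poly R},
  (1 - 'X^2) ^+ 2 * (mehler_prod T x y)^`()
  = (\sum_(m < n) mehler_factor (x m) (y m)) * mehler_prod T x y + 'X^T * J.
Proof.
rewrite /mehler_prod.
pose P (p q : {poly R}) :=
  exists J : {poly R}, (1 - 'X^2) ^+ 2 * p^`() = q * p + 'X^T * J.
apply: (big_ind2 P) => [|p q p' q' [J pJ] [J' pJ']|m _].
- by exists 0; rewrite derivC !(mulr0, mul0r, addr0).
- exists (J * p' + J' * p); rewrite derivM mulrDr.
  transitivity ((1 - 'X^2) ^+ 2 * p^`() * p' + (1 - 'X^2) ^+ 2 * p'^`() * p).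
    by ring.
  by rewrite pJ pJ'; ring.
- exact: mehler_poly_ode.
Qed.

Lemma mehler_prod0 T x y : (mehler_prod T x y)`_0 = 1.
Proof.
rewrite -horner_coef0 horner_prod big1 // => m _.
by rewrite horner_coef0 coef_poly /= /mehler_coef /= fact0 divr1 mulr1.
Qed.

(** On the sphere of squared radius n the logarithmic derivative of the product
    is n (1 + r^2) (t - r) / (1 - r^2)^2 with t = <x, y>.  Absorbing the factor
    1 + r^2 that multiplies t leaves a recurrence for t times a coefficient that
    has finitely many terms. *)
Definition zonal T x y : {poly R} := (1 + 'X^2) * mehler_prod T x y.

(** Multiplication by the inner product acts on the zonal kernels almost as a
    Jacobi matrix; the one additional term is a nonnegative multiple of a
    kernel with a Gram representation, so it can be dropped in lower bounds. *)
Lemma zonal_rec T x y j :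
  \sum_m x m ^+ 2 = n%:R -> \sum_m y m ^+ 2 = n%:R -> (j < T)%N ->
  (\sum_m x m * y m) * (zonal T x y)`_j
  = j.+1%:R * (zonal T x y)`_j.+1
    + (if j is i.+1 then (n%:R - 3 * j%:R + 1) * (zonal T x y)`_i else 0)
    + (if j is i.+3 then 4 * i.+2%:R * (mehler_prod T x y)`_i else 0).
Proof.
move=> x_n y_n jT; set t := \sum_m x m * y m.
have [J ode] := mehler_prod_ode T x y.
have sumF : \sum_(m < n) mehler_factor (x m) (y m)
    = t%:P * (1 + 'X^2) - n%:R%:P * ('X * (1 + 'X^2)).
  rewrite /mehler_factor sumrB big_split /= -!mulr_suml -!rmorph_sum /=.
  rewrite -/t big_split /= x_n y_n sumr_const card_ord -mulr_natl polyCD ?polyC_natr.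
  by ring.
rewrite {}sumF in ode.
set E := mehler_prod T x y in ode *; set Q := zonal T x y.
have QE : Q = E + 'X^2 * E by rewrite /Q /zonal -/E; ring.
have Q'E : Q^`() = (1 + 'X^2) * E^`() + 'X * E *+ 2.
  by rewrite QE derivD derivM derivXn /= expr1; ring.
have tQ : t%:P * Q = Q^`() - 'X^2 * Q^`() *+ 3 + (n%:R - 2)%:P * ('X * Q)
    + 'X^4 * E^`() *+ 4 + 'X^3 * E *+ 8 - 'X^T * J.
  have -> : 'X^T * J = (1 - 'X^2) ^+ 2 * E^`()
      - (t%:P * (1 + 'X^2) - n%:R%:P * ('X * (1 + 'X^2))) * E.
    by rewrite ode; ring.
  by rewrite Q'E QE polyCB polyC_natr; ring.
have := congr1 (fun p : {poly R} => p`_j) tQ.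
rewrite !(coefD, coefB, coefN, coefMn, coefCM, coefXnM, coefXM, coef_deriv) jT.
move=> ->; case: j {tQ jT} => [|[|[|j]]] /=;
  rewrite ?(subn0, subSS, subnn) /=; try ring.
by case: j => [|j]; rewrite ?(subn0, subSS) /=; ring.
Qed.
End Kernels.

(** * Positive semidefinite kernels with Hermite features *)

Lemma sqr_sum_le_card (R : realDomainType) (I : finType) (P : pred I) (z : I -> R) :
  (\sum_(i | P i) z i) ^+ 2 <= #|P|%:R * \sum_(i | P i) z i ^+ 2.
Proof.
have : 0 <= \sum_(i | P i) \sum_(j | P j) (z i - z j) ^+ 2.
  by do 2![apply: sumr_ge0 => ? _]; exact: sqr_ge0.
have -> : \sum_(i | P i) \sum_(j | P j) (z i - z j) ^+ 2
    = 2 * (#|P|%:R * \sum_(i | P i) z i ^+ 2 - (\sum_(i | P i) z i) ^+ 2).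
  transitivity (\sum_(i | P i) (#|P|%:R * z i ^+ 2 + \sum_(j | P j) z j ^+ 2
      + - 2 * (z i * \sum_(j | P j) z j))).
    apply: eq_bigr => i _.
    transitivity (\sum_(j | P j) (z i ^+ 2 + z j ^+ 2 + (- 2 * z i) * z j)).
      by apply: eq_bigr => j _; ring.
    by rewrite !big_split /= -!mulr_sumr sumr_const; ring.
  rewrite !big_split /= -!mulr_sumr -mulr_suml sumr_const -[_ *+ #|P|]mulr_natl.
  by ring.
by rewrite pmulr_rge0 // subr_ge0.
Qed.


Section Kernels.
Context {R : realFieldType} {n : nat}.
Implicit Types (x y : 'I_n -> R) (T : nat).

Definition multidegree T (f : {ffun 'I_n -> 'I_T.+1}) : nat := \sum_m f m.

Definition hermite_feature T (f : {ffun 'I_n -> 'I_T.+1}) x : R :=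
  \prod_m hermite (f m) (x m).

Definition hermite_weight T (f : {ffun 'I_n -> 'I_T.+1}) : R :=
  \prod_m ((f m)`!%:R)^-1.

Lemma hermite_weight_ge0 T (f : {ffun 'I_n -> 'I_T.+1}) :
  0 <= hermite_weight f.
Proof. by apply: prodr_ge0 => m _; rewrite invr_ge0. Qed.

(** The Gram representation: distribute the product of the coordinate series. *)
Lemma coef_mehler_prod T x y l :
  (mehler_prod T x y)`_l = \sum_(f : {ffun 'I_n -> 'I_T.+1})
    (multidegree f == l)%:R * hermite_weight f
      * (hermite_feature f x * hermite_feature f y).
Proof.
rewrite /mehler_prod.
under eq_bigr => m _ do rewrite /mehler_poly poly_def.
rewrite bigA_distr_bigA /= coef_sum; apply: eq_bigr => f _.
rewrite scaler_prod prodrXr coefZ coefXn eq_sym mulrC -mulrA.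
congr (_ * _); rewrite mulrC -!big_split /=.
by apply: eq_bigr => m _; rewrite /mehler_coef.
Qed.

Lemma mehler_prod_diag_ge0 T x l : 0 <= (mehler_prod T x x)`_l.
Proof.
rewrite coef_mehler_prod; apply: sumr_ge0 => f _.
by rewrite mulr_ge0 -?expr2 ?sqr_ge0 // mulr_ge0 ?hermite_weight_ge0.
Qed.

Lemma zonal_coef T x y j : (zonal T x y)`_j
  = (mehler_prod T x y)`_j + (if j is i.+2 then (mehler_prod T x y)`_i else 0).
Proof.
rewrite /zonal mulrDl mul1r coefD coefXnM.
by case: j => [|[|j]] //=; rewrite !subSS subn0.
Qed.

Lemma zonal_diag_ge0 T x j : 0 <= (zonal T x x)`_j.
Proof.
rewrite zonal_coef addr_ge0 ?mehler_prod_diag_ge0 //.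
by case: j => [|[|j]] //; exact: mehler_prod_diag_ge0.
Qed.

(** On the diagonal t = n, so the recurrence bounds n Q_(j+1) below by
    (n - 3 j - 2) Q_j, and the induction starts from Q_0 = 1. *)
Lemma zonal_diag_gt0 T x j : \sum_m x m ^+ 2 = n%:R ->
  (3 * T <= n)%N -> (j < T)%N -> 0 < (zonal T x x)`_j.
Proof.
move=> xn Tn; elim: j => [|j IHj] jT.
  by rewrite zonal_coef mehler_prod0 addr0.
have n0 : 0 < n%:R :> R by rewrite ltr0n; lia.
have := zonal_rec xn xn jT.
have -> : \sum_m x m * x m = n%:R.
  by rewrite -xn; apply: eq_bigr => m _; rewrite expr2.
move=> rec; rewrite -(pmulr_rgt0 _ n0) rec.
rewrite -addrA addrCA ltr_pwDl ?mulr_gt0 ?IHj //; last 2 first.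
- by apply: ltnW.
- apply: addr_ge0; first by rewrite mulr_ge0 ?zonal_diag_ge0.
  by case: j {IHj jT rec} => [|[|i]] //; rewrite !mulr_ge0 ?mehler_prod_diag_ge0.
have : 3 * j.+1%:R <= n%:R :> R by rewrite -natrM ler_nat; lia.
by lra.
Qed.

End Kernels.

Section Cone.
Context {R : realFieldType} {n T : nat} {I : finType}.
Context (p : I -> 'I_n -> R).

(** Kernels with a Gram representation in the Hermite features of degree less
    than [k]; up to the normalisation of the features, the weight depends on the
    degree alone.  Recording the bound [k] gives control of the rank. *)
Definition psd_kernel (k : nat) (K : I -> I -> R) :=
  exists d : nat -> R, [/\ forall l, 0 <= d l, forall l, (k <= l)%N -> d l = 0
    & forall i j, K i j = \sum_(f : {ffun 'I_n -> 'I_T.+1})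
       d (multidegree f) * hermite_weight f
         * (hermite_feature f (p i) * hermite_feature f (p j))].

Lemma psd_kernel_ext k K K' :
  psd_kernel k K -> (forall i j, K' i j = K i j) -> psd_kernel k K'.
Proof. by move=> [d [? ? KE]] K'E; exists d; split=> // i j; rewrite K'E. Qed.

Lemma psd_kernel0 k : psd_kernel k (fun _ _ => 0).
Proof.
exists (fun=> 0); split=> // i j.
by rewrite big1 // => f _; rewrite !mul0r.
Qed.

Lemma psd_kernelD k K K' : psd_kernel k K -> psd_kernel k K' ->
  psd_kernel k (fun i j => K i j + K' i j).
Proof.
move=> [d [d0 dk KE]] [d' [d'0 d'k K'E]].
exists (fun l => d l + d' l); split=> [l|l kl|i j].
- by rewrite addr_ge0.
- by rewrite dk // d'k // addr0.
- by rewrite KE K'E -big_split; apply: eq_bigr => f _; rewrite /=; ring.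
Qed.

Lemma psd_kernelZ k a K : 0 <= a -> psd_kernel k K ->
  psd_kernel k (fun i j => a * K i j).
Proof.
move=> a0 [d [d0 dk KE]]; exists (fun l => a * d l); split=> [l|l kl|i j].
- by rewrite mulr_ge0.
- by rewrite dk // mulr0.
- by rewrite KE mulr_sumr; apply: eq_bigr => f _; ring.
Qed.

Lemma psd_kernel_sum k (J : finType) (P : pred J) (K : J -> I -> I -> R) :
  (forall s, P s -> psd_kernel k (K s)) ->
  psd_kernel k (fun i j => \sum_(s | P s) K s i j).
Proof.
move=> Kk; elim: (index_enum J) => [|s r IHr].
  by apply: psd_kernel_ext (psd_kernel0 k) _ => i j; rewrite big_nil.
have [Ps|nPs] := boolP (P s).
  apply: psd_kernel_ext (psd_kernelD (Kk s Ps) IHr) _ => i j.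
  by rewrite big_cons Ps.
by apply: psd_kernel_ext IHr _ => i j; rewrite big_cons (negPf nPs).
Qed.

Lemma psd_kernel_mehler k l : (l < k)%N ->
  psd_kernel k (fun i j => (mehler_prod T (p i) (p j))`_l).
Proof.
move=> lk; exists (fun j => (j == l)%:R); split=> [//|j kj|i j].
  by rewrite gtn_eqF // (leq_trans lk).
by rewrite coef_mehler_prod.
Qed.

Lemma psd_kernel_zonal k l : (l < k)%N ->
  psd_kernel k (fun i j => (zonal T (p i) (p j))`_l).
Proof.
move=> lk; apply: psd_kernel_ext (fun i j => zonal_coef _ _ _ _).
apply: psd_kernelD; first exact: psd_kernel_mehler.
case: l lk => [|[|l]] lk; [exact: psd_kernel0 | exact: psd_kernel0 |].
by apply: psd_kernel_mehler; lia.
Qed.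

(** Schur's product theorem: the sum is a weighted sum of squares, indexed by
    pairs of features. *)
Lemma psd_kernel_mul_ge0 k k' K K' (a : I -> R) :
  psd_kernel k K -> psd_kernel k' K' ->
  0 <= \sum_i \sum_j a i * a j * (K i j * K' i j).
Proof.
move=> [d [d0 _ KE]] [d' [d'0 _ K'E]].
pose H f i := hermite_feature (T := T) f (p i).
pose S f f' := \sum_i a i * H f i * H f' i.
rewrite [leRHS](_ : _ = \sum_f \sum_f' d (multidegree f) * hermite_weight f
  * (d' (multidegree f') * hermite_weight f') * S f f' ^+ 2).
  apply: sumr_ge0 => f _; apply: sumr_ge0 => f' _.
  by rewrite mulr_ge0 ?sqr_ge0 // !mulr_ge0 ?hermite_weight_ge0.
transitivity (\sum_i \sum_j \sum_f \sum_f' d (multidegree f) * hermite_weight f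
  * (d' (multidegree f') * hermite_weight f')
  * ((a i * H f i * H f' i) * (a j * H f j * H f' j))).
  apply: eq_bigr => i _; apply: eq_bigr => j _.
  rewrite KE K'E mulr_suml mulr_sumr; apply: eq_bigr => f _.
  by rewrite !mulr_sumr; apply: eq_bigr => f' _; rewrite /H; ring.
under eq_bigr => i _ do rewrite exchange_big /=.
rewrite exchange_big /=; apply: eq_bigr => f _.
under eq_bigr => i _ do rewrite exchange_big /=.
rewrite exchange_big /=; apply: eq_bigr => f' _.
rewrite expr2 {1}/S mulr_suml mulr_sumr; apply: eq_bigr => i _.
by rewrite /S !mulr_sumr; apply: eq_bigr => j _.
Qed.

(** A matrix of rank D satisfies (tr K)^2 <= D tr (K^2).  The Gram matrix is
    replaced by the moment matrix of the features, which has the same trace and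
    the same Hilbert-Schmidt norm, and whose diagonal has only D nonzero
    entries. *)
Lemma psd_kernel_trace k K (a : I -> R) : psd_kernel k K ->
  (\sum_i a i * K i i) ^+ 2 <=
  #|[pred f : {ffun 'I_n -> 'I_T.+1} | (multidegree f < k)%N]|%:R
    * \sum_i \sum_j a i * a j * K i j ^+ 2.
Proof.
move=> [d [d0 dk KE]].
pose H f i := hermite_feature (T := T) f (p i).
pose c (f : {ffun 'I_n -> 'I_T.+1}) := d (multidegree f) * hermite_weight f.
pose S f f' := \sum_i a i * H f i * H f' i.
have c0 f : 0 <= c f by rewrite mulr_ge0 ?hermite_weight_ge0.
pose P (f : {ffun 'I_n -> 'I_T.+1}) := (multidegree f < k)%N.
have -> : \sum_i a i * K i i = \sum_(f | P f) c f * S f f.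
  transitivity (\sum_i \sum_f c f * (a i * H f i * H f i)).
    apply: eq_bigr => i _; rewrite KE mulr_sumr; apply: eq_bigr => f _.
    by rewrite /c /H; ring.
  rewrite exchange_big /= [RHS]big_mkcond; apply: eq_bigr => f _.
  rewrite -mulr_sumr; case: ifPn => //; rewrite /P -leqNgt => kf.
  by rewrite /c dk // !mul0r.
apply: le_trans (sqr_sum_le_card _ _) _; rewrite ler_wpM2l //.
have -> : \sum_i \sum_j a i * a j * K i j ^+ 2
    = \sum_f \sum_f' c f * c f' * S f f' ^+ 2.
  transitivity (\sum_i \sum_j \sum_f \sum_f' c f * c f'
    * ((a i * H f i * H f' i) * (a j * H f j * H f' j))).
    apply: eq_bigr => i _; apply: eq_bigr => j _.
    rewrite KE expr2 mulr_suml mulr_sumr; apply: eq_bigr => f _.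
    by rewrite !mulr_sumr; apply: eq_bigr => f' _; rewrite /H /c; ring.
  under eq_bigr => i _ do rewrite exchange_big /=.
  rewrite exchange_big /=; apply: eq_bigr => f _.
  under eq_bigr => i _ do rewrite exchange_big /=.
  rewrite exchange_big /=; apply: eq_bigr => f' _.
  rewrite expr2 {1}/S mulr_suml mulr_sumr; apply: eq_bigr => i _.
  by rewrite /S !mulr_sumr; apply: eq_bigr => j _.
rewrite big_mkcond; apply: ler_sum => f _ /=.
have F0 f' : 0 <= c f * c f' * S f f' ^+ 2 by rewrite mulr_ge0 ?sqr_ge0 // mulr_ge0.
rewrite (bigD1 f) //=; apply: (@le_trans _ _ (c f * c f * S f f ^+ 2)).
  by case: ifP => // _; rewrite exprMn expr2.
by rewrite lerDl sumr_ge0.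
Qed.

End Cone.

(** * The spherical code bound *)

Section Bound.
Context {R : realFieldType} {n k : nat} {I : finType}.
Context (p : I -> 'I_n -> R) (c : nat -> R) (L : R).
Context (kn : (3 * k <= n)%N).
Context (p_sphere : forall i, \sum_m p i m ^+ 2 = n%:R).
Context (c_ge0 : forall j, 0 <= c j).
Context (c_eq0 : forall j, (k <= j)%N -> c j = 0).
Context (c_eigen : forall j, (j <= k)%N ->
  L * c j <= j%:R * c j.-1 + (n%:R - 3 * j%:R - 2) * c j.+1).

Let Q i j := zonal k (p i) (p j).
Let t i j := \sum_m p i m * p j m.
(** The kernel of the linear programming bound. *)
Definition test_kernel i j := \sum_(l < k) c l * (zonal k (p i) (p j))`_l.
Let g := test_kernel.

Lemma psd_test_kernel : psd_kernel (T := k) p k g.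
Proof.
apply: psd_kernel_sum => l _; apply: psd_kernelZ => //.
exact: psd_kernel_zonal.
Qed.

(** Expanding t times the test kernel by [zonal_rec] and collecting terms, the
    coefficient of each zonal kernel is nonnegative by [c_eigen], and what
    remains are the nonnegative extra terms of the recurrence. *)
Lemma psd_test_kernel_mul :
  psd_kernel (T := k) p k.+1 (fun i j => (t i j - L) * g i j).
Proof.
pose r l i j : R :=
  if l is s.+3 then 4 * s.+2%:R * (mehler_prod k (p i) (p j))`_s else 0.
pose e l := l%:R * c l.-1 + (n%:R - 3 * l%:R - 2) * c l.+1 - L * c l.
have e0 l : (l < k.+1)%N -> 0 <= e l.
  by rewrite ltnS => /c_eigen; rewrite subr_ge0.
suff tgE i j : (t i j - L) * g i j
    = \sum_(l < k.+1) e l * (Q i j)`_l + \sum_(l < k) c l * r l i j.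
  apply: psd_kernel_ext tgE; apply: psd_kernelD; apply: psd_kernel_sum => l _.
    by apply: psd_kernelZ; [exact: e0 | exact: psd_kernel_zonal].
  apply: psd_kernelZ => //; rewrite /r.
  case: (l : nat) (ltn_ord l) => [|[|[|s]]] sk; try exact: psd_kernel0.
  by apply: psd_kernelZ; [rewrite mulr_ge0 | apply: psd_kernel_mehler; lia].
rewrite /g /test_kernel mulrBl.
have -> : t i j * \sum_(l < k) c l * (Q i j)`_l
  = \sum_(l < k) (l.+1%:R * c l * (Q i j)`_l.+1)
    + \sum_(l < k) (if l : nat is s.+1 then
        (n%:R - 3 * s%:R - 2) * c s.+1 * (Q i j)`_s else 0)
    + \sum_(l < k) c l * r l i j.
  rewrite mulr_sumr -!big_split; apply: eq_bigr => l _ /=.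
  rewrite mulrCA (zonal_rec (p_sphere i) (p_sphere j) (ltn_ord l)) /r -/(Q i j).
  case: (l : nat) => [|[|[|s]]] /=; ring.
rewrite addrAC; congr (_ + _).
have -> : \sum_(l < k.+1) e l * (Q i j)`_l
  = \sum_(l < k.+1) l%:R * c l.-1 * (Q i j)`_l
   + \sum_(l < k.+1) (n%:R - 3 * l%:R - 2) * c l.+1 * (Q i j)`_l
   - L * \sum_(l < k.+1) c l * (Q i j)`_l.
  rewrite mulr_sumr -big_split -sumrB /=; apply: eq_bigr => l _.
  by rewrite /e; ring.
congr (_ + _ - L * _).
- by rewrite [RHS]big_ord_recl /= !mul0r add0r.
- case: k c_eq0 => [|k'] ck.
    by rewrite big_ord0 big_ord_recl big_ord0 ck // mulr0 mul0r addr0.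
  rewrite big_ord_recl add0r !big_ord_recr /=.
  rewrite (ck k'.+1) // (ck k'.+2) // !(mulr0, mul0r) !addr0.
  by apply: eq_bigr.
- by rewrite big_ord_recr /= c_eq0 // mul0r addr0.
Qed.

Context (c_gt0 : exists2 j, (j < k)%N & 0 < c j).

Lemma test_kernel_diag_gt0 i : 0 < g i i.
Proof.
have [j jk cj] := c_gt0.
rewrite /g /test_kernel (bigD1 (Ordinal jk)) //= ltr_pwDl //.
  by rewrite mulr_gt0 // zonal_diag_gt0.
by apply: sumr_ge0 => l _; rewrite mulr_ge0 // zonal_diag_ge0.
Qed.

(** The points are weighted by the inverse of the diagonal values of the test
    kernel, which normalises its diagonal to 1. *)
Lemma spherical_code_card_le (s : R) : s <= n%:R -> s < L ->
  (forall i j, i != j -> t i j <= s) ->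
  #|I|%:R * (L - s) <=
  #|[pred f : {ffun 'I_n -> 'I_k.+1} | (multidegree f < k)%N]|%:R * (n%:R - s).
Proof.
move=> sn sL ts; set D := (X in _ <= X * _).
have [->|I_gt0] := posnP #|I|.
  by rewrite mul0r mulr_ge0 // subr_ge0.
pose a i := (g i i)^-1.
have a0 i : 0 < a i by rewrite invr_gt0 test_kernel_diag_gt0.
have ag i : a i * g i i = 1.
  by rewrite mulVf // gt_eqF // test_kernel_diag_gt0.
set W := \sum_i \sum_j a i * a j * g i j ^+ 2.
have WD : #|I|%:R ^+ 2 <= D * W.
  have := psd_kernel_trace a psd_test_kernel.
  by under eq_bigr => i _ do rewrite ag; rewrite sumr_const.
have LW : L * W <= \sum_i \sum_j a i * a j * (t i j * g i j ^+ 2).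
  have := psd_kernel_mul_ge0 a psd_test_kernel psd_test_kernel_mul.
  rewrite -(subr_ge0 (L * W)); congr (0 <= _).
  rewrite mulr_sumr -sumrB; apply: eq_bigr => i _.
  by rewrite mulr_sumr -sumrB; apply: eq_bigr => j _; ring.
have WN : (L - s) * W <= #|I|%:R * (n%:R - s).
  apply: (@le_trans _ _ (\sum_i \sum_j a i * a j * ((t i j - s) * g i j ^+ 2))).
    rewrite mulrBl lerBlDr; apply: le_trans LW _.
    rewrite mulr_sumr -big_split /=; apply: ler_sum => i _.
    rewrite mulr_sumr -big_split /=; apply: ler_sum => j _.
    by rewrite -lerBlDr le_eqVlt; apply/orP; left; apply/eqP; ring.
  have -> : #|I|%:R * (n%:R - s) = \sum_(i : I) (n%:R - s).
    by rewrite sumr_const mulr_natl.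
  apply: ler_sum => i _; rewrite (bigD1 i) //= -[leRHS]addr0 lerD //.
    have -> : t i i = n%:R.
      by rewrite -(p_sphere i); apply: eq_bigr => m _; rewrite expr2.
    rewrite [leLHS](_ : _ = (a i * g i i) ^+ 2 * (n%:R - s)); last by ring.
    by rewrite ag expr1n mul1r.
  apply: sumr_le0 => j ji; rewrite mulr_ge0_le0 //.
    by rewrite mulr_ge0 // ltW.
  by rewrite mulr_le0_ge0 ?sqr_ge0 // subr_le0 ts // eq_sym.
have N0 : 0 < #|I|%:R :> R by rewrite ltr0n.
rewrite -(ler_pM2l N0) mulrA -expr2.
apply: le_trans (ler_wpM2r _ WD) _; first by rewrite subr_ge0 ltW.
by rewrite -mulrA [leRHS]mulrCA ler_wpM2l // mulrC.
Qed.

End Bound.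

(** Rankin's trick: each multi-index of degree less than [k] contributes at
    least y^k to the generating function, which is at most (1 - y)^-n. *)
Lemma multidegree_card_le (R : realFieldType) (n T k : nat) (y : R) :
  0 < y -> y < 1 ->
  #|[pred f : {ffun 'I_n -> 'I_T.+1} | (multidegree f < k)%N]|%:R
    * (y ^+ k * (1 - y) ^+ n) <= 1.
Proof.
move=> y0 y1; have y'0 : 0 <= 1 - y by rewrite subr_ge0 ltW.
rewrite mulrA; apply: (@le_trans _ _
  ((\sum_(f : {ffun 'I_n -> 'I_T.+1}) y ^+ multidegree f) * (1 - y) ^+ n)).
  rewrite ler_wpM2r ?exprn_ge0 // mulr_natl -sumr_const big_mkcond /=.
  apply: ler_sum => f _; case: ifP => [|_]; last by rewrite exprn_ge0 // ltW.
  rewrite unfold_in /= => fk.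
  by apply: ler_wiXn2l; [exact: ltW | exact: ltW | exact: ltnW].
have -> : \sum_(f : {ffun 'I_n -> 'I_T.+1}) y ^+ multidegree f
    = \prod_(m < n) \sum_(a < T.+1) y ^+ a.
  rewrite bigA_distr_bigA; apply: eq_bigr => f _.
  by rewrite prodrXr.
have -> : \prod_(m < n) \sum_(a < T.+1) y ^+ a = (\sum_(a < T.+1) y ^+ a) ^+ n.
  by rewrite prodr_const card_ord.
have geom : (\sum_(a < T.+1) y ^+ a) * (1 - y) = 1 - y ^+ T.+1.
  rewrite mulrC -[X in _ = X - _](expr1n _ T.+1) subrXX; congr (_ * _).
  by apply: eq_bigr => a _; rewrite expr1n mul1r.
rewrite -exprMn geom exprn_ile1 //.
  by rewrite subr_ge0 exprn_ile1 ?ltW.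
by rewrite gerBl exprn_ge0 // ltW.
Qed.

(** * The exponential rate *)

Section Numeric.
Context {R : realFieldType}.

(** The two sides differ by nearly 5 percent, so repeated squaring with small
    fractions, rounded down at each step, is precise enough. *)
Lemma growth_rate_ge : 293 <= ((292 / 293) * (2504 / 2447)) ^+ 292 :> R.
Proof.
have sq (e : nat) (b u v : R) : 0 <= u -> u <= b ^+ e -> v <= u ^+ 2 ->
    v <= b ^+ (e * 2).
  move=> u0 ub vu; apply: le_trans vu _; rewrite exprM.
  by rewrite lerXn2r // nnegrE // (le_trans u0).
set b := _ * _.
have b1 : 979 / 960 <= b ^+ 1 by rewrite expr1 /b; lra.
have b2 : 1015 / 976 <= b ^+ 2 by apply: (sq 1%N _ _ _ _ b1); clear; lra.
have b4 : 743 / 687 <= b ^+ 4 by apply: (sq 2 _ _ _ _ b2); clear; lra.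
have b8 : 1103 / 943 <= b ^+ 8 by apply: (sq 4 _ _ _ _ b4); clear; lra.
have b16 : 1219 / 891 <= b ^+ 16 by apply: (sq 8 _ _ _ _ b8); clear; lra.
have b32 : 1737 / 928 <= b ^+ 32 by apply: (sq 16 _ _ _ _ b16); clear; lra.
have b64 : 1997 / 570 <= b ^+ 64 by apply: (sq 32 _ _ _ _ b32); clear; lra.
have b128 : 626 / 51 <= b ^+ 128 by apply: (sq 64 _ _ _ _ b64); clear; lra.
have b256 : 2561 / 17 <= b ^+ 256 by apply: (sq 128 _ _ _ _ b128); clear; lra.
rewrite (exprD b 256 36) (exprD b 32 4).
apply: (@le_trans _ _ ((2561 / 17) * ((1737 / 928) * (743 / 687)))); first by clear; lra.
apply: ler_pM; [by clear; lra | by clear; lra | exact: b256 |].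
by apply: ler_pM; [clear; lra | clear; lra | exact: b32 | exact: b4].
Qed.

(** The factor 17^-j balances the two off-diagonal terms of the recurrence at
    j = n / 292: there 17 j and (n - 3 j) / 17 both equal 17 n / 292, which is
    why the window ends near this index.  The bump (j - m) (m + 1001 - j) has
    second difference -2, a loss of a fraction 1 / 1000 at most; truncated
    subtraction makes it vanish outside the window. *)
Definition window_coef (m j : nat) : R :=
  17^-1 ^+ j * ((j - m) * (m + 1001 - j))%N%:R.

Lemma window_coef_ge0 m j : 0 <= window_coef m j.
Proof. by rewrite mulr_ge0 // exprn_ge0 // invr_ge0. Qed.

Lemma window_coef_eq0 m j : (m + 1001 <= j)%N -> window_coef m j = 0.
Proof. by move=> mj; rewrite /window_coef (eqP mj) muln0 mulr0. Qed.

(** The recurrence inside the window, with N = n, M = m and j = M + r + 1, after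
    division by the geometric factor.  Both off-diagonal coefficients are at
    least 0.05817 N, and twice this number exceeds 0.1162 by more than the loss
    caused by the second difference of the bump. *)
Lemma window_ineq (N M r : R) : 4 * 10 ^+ 8 <= N -> N / 292 - 1002 <= M ->
  M + r + 1 <= N / 292 -> 0 <= r -> r <= 999 ->
  N * (1162 / 10 ^+ 4) * ((r + 1) * (1000 - r))
  <= 17 * (M + r + 1) * (r * (1001 - r))
     + (N - 3 * (M + r + 1) - 2) / 17 * ((r + 2) * (999 - r)).
Proof.
move=> N_big NM jN r0 r999.
have N0 : 0 <= N by clear -N_big; lra.
have p1 : 0 <= r * (1001 - r) by apply: mulr_ge0; [exact: r0 | clear -r999; lra].
have p2 : 0 <= (r + 2) * (999 - r).
  by apply: mulr_ge0; [clear -r0 | clear -r999]; lra.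
have l1 : 5817 / 10 ^+ 5 * N <= 17 * (M + r + 1).
  by clear -N_big NM r0; lra.
have l2 : 5817 / 10 ^+ 5 * N <= (N - 3 * (M + r + 1) - 2) / 17.
  by clear -N_big jN; lra.
apply: le_trans (lerD (ler_wpM2r p1 l1) (ler_wpM2r p2 l2)).
have w_big : 0 <= N * (r * (999 - r)).
  by apply: mulr_ge0 N0 (mulr_ge0 r0 _); rewrite subr_ge0.
by clear -N0 w_big; lra.
Qed.

(** The eigenvalue 0.1162 n lies between the admissible inner product 0.1161 n
    and the limit 34 n / 292 = 0.11643 n. *)
Lemma window_coef_eigen (n m j : nat) : (0 < m)%N ->
  (m + 1001 = n %/ 292)%N -> 4 * 10 ^+ 8 <= n%:R :> R -> (j <= m + 1001)%N ->
  n%:R * (1162 / 10 ^+ 4) * window_coef m j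
  <= j%:R * window_coef m j.-1 + (n%:R - 3 * j%:R - 2) * window_coef m j.+1.
Proof.
move=> m0 mn n_big jm.
have c292 : 0 < 292 :> R by rewrite ltr0n.
have jn : j%:R <= n%:R / 292 :> R.
  rewrite (ler_pdivlMr _ _ c292) -natrM ler_nat.
  by apply: leq_trans (leq_trunc_div n 292); rewrite leq_mul2r -mn jm orbT.
have [jm'|mj] := leqP j m.
  rewrite {1}/window_coef (eqP jm') mul0n mulr0n !mulr0.
  by rewrite addr_ge0 // mulr_ge0 ?window_coef_ge0 //; lra.
have [jE|jk] := eqVneq j (m + 1001)%N.
  have -> : window_coef m j = 0 by rewrite window_coef_eq0 ?jE.
  by rewrite mulr0 addr_ge0 // mulr_ge0 ?window_coef_ge0 //; lra.
have nm : n%:R / 292 - 1002 <= m%:R :> R.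
  rewrite lerBlDr (ler_pdivrMr _ _ c292) -natrD -natrM ler_nat.
  by have := divn_eq n 292; have := ltn_pmod n (isT : 0 < 292)%N; lia.
have [q jE q999] : exists2 q, j = (m + q).+1 & (q <= 999)%N.
  by exists (j - m).-1; lia.
rewrite {j}jE in jn jm mj jk *.
rewrite /window_coef /=.
have -> : ((m + q).+1 - m)%N = q.+1 by lia.
have -> : ((m + q).+2 - m)%N = q.+2 by lia.
have -> : (m + q - m)%N = q by lia.
have -> : (m + 1001 - (m + q).+1)%N = (1000 - q)%N by lia.
have -> : (m + 1001 - (m + q).+2)%N = (999 - q)%N by lia.
have -> : (m + 1001 - (m + q))%N = (1001 - q)%N by lia.
have q1001 : (q <= 1001)%N by exact: leq_trans q999 _.
have q1000 : (q <= 1000)%N by exact: leq_trans q999 _.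
rewrite !natrM (natrB R q1001) (natrB R q1000) (natrB R q999).
set u := 17^-1 ^+ (m + q); rewrite !exprS -/u.
have u0 : 0 < u by rewrite exprn_gt0 // invr_gt0.
rewrite -[q.+2]addn2 -[(m + q).+1]addn1 -[q.+1]addn1 !natrD in jn *.
have q0 : 0 <= q%:R :> R by [].
have q9 : q%:R <= 999 :> R by rewrite ler_nat.
have mid := window_ineq n_big nm jn q0 q9.
have u17 : 0 <= u / 17 by rewrite divr_ge0 // ltW.
have {mid} := ler_wpM2l u17 mid; clear.
set r : R := q%:R; set M : R := m%:R; set N : R := n%:R; clearbody r M N u.
by lra.
Qed.

Lemma multidegree_card_le_rate (n k T : nat) : (k * 292 <= n)%N ->
  #|[pred f : {ffun 'I_n -> 'I_T.+1} | (multidegree f < k)%N]|%:R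
  <= (2504 / 2447) ^+ n :> R.
Proof.
move=> kn.
have y0 : 0 < 293^-1 :> R by clear; lra.
have y1 : 293^-1 < 1 :> R by clear; lra.
have yx : 1 - 293^-1 = 292 / 293 :> R by clear; lra.
have yV : (293^-1)^-1 = 293 :> R by rewrite invrK.
have b1 : 1 <= (292 / 293) * (2504 / 2447) :> R by clear; lra.
have x0 : 0 < 292 / 293 :> R by clear; lra.
have rate := growth_rate_ge.
have := @multidegree_card_le R n T k _ y0 y1.
rewrite yx; rewrite -[X in X <= _]yV in rate; move: y0 {y1 yx yV} b1 x0 rate.
move: (293^-1 : R) (292 / 293 : R) (2504 / 2447 : R) => y x z y0 b1 x0 rate.
set D := #|_| => D1.
have b0 : 0 <= x * z by apply: le_trans ler01 b1.
have bk : y ^- k <= (x * z) ^+ n.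
  apply: (@le_trans _ _ ((x * z) ^+ (292 * k))).
    rewrite exprM -exprVn; apply: lerXn2r rate; rewrite nnegrE.
      by rewrite invr_ge0 ltW.
    exact: exprn_ge0.
  by rewrite ler_weXn2l // mulnC.
rewrite exprMn in bk.
have xn0 : 0 < x ^+ n by exact: exprn_gt0.
have yk0 : 0 < y ^+ k by exact: exprn_gt0.
rewrite -(ler_pM2l xn0); apply: le_trans bk.
rewrite -(ler_pM2l yk0) divff ?gt_eqF //.
by apply: le_trans D1; rewrite [leRHS]mulrC -mulrA.
Qed.

Lemma spherical_code_exponential_bound (n : nat) (I : finType)
    (p : I -> 'I_n -> R) : 4 * 10 ^+ 8 <= n%:R :> R ->
  (forall i, \sum_m p i m ^+ 2 = n%:R) ->
  (forall i j, i != j -> \sum_m p i m * p j m <= 1161 / 10 ^+ 4 * n%:R) ->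
  #|I|%:R <= 10 ^+ 4 * (2504 / 2447) ^+ n :> R.
Proof.
move=> n_big p_sphere p_sep.
set k := (n %/ 292)%N.
have k_big : (1001 < k)%N.
  rewrite /k leq_divRL // -(ler_nat R) natrM.
  by apply: le_trans n_big; lra.
have [m m0 km] : exists2 m, (0 < m)%N & (m + 1001)%N = k.
  by exists (k - 1001)%N; lia.
have kn292 : (k * 292 <= n)%N by exact: leq_trunc_div.
have N0 : 0 < n%:R :> R by lra.
have NB : #|I|%:R * (n%:R * (1162 / 10 ^+ 4) - 1161 / 10 ^+ 4 * n%:R) <=
    #|[pred f : {ffun 'I_n -> 'I_k.+1} | (multidegree f < k)%N]|%:R
      * (n%:R - 1161 / 10 ^+ 4 * n%:R) :> R.
  apply: (@spherical_code_card_le _ _ _ _ p (window_coef m)) => //.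
  - by lia.
  - exact: window_coef_ge0.
  - by move=> j kj; rewrite window_coef_eq0 // km.
  - by move=> j jk; apply: window_coef_eigen => //; rewrite km.
  - exists (m + 1000)%N; first by lia.
    rewrite mulr_gt0 ?exprn_gt0 ?invr_gt0 // ltr0n muln_gt0.
    by apply/andP; split; lia.
  - by lra.
  - by lra.
set D := (X in _ <= X%:R * _) in NB.
have Dn : D%:R <= (2504 / 2447) ^+ n :> R by exact: multidegree_card_le_rate.
have : #|I|%:R <= 10 ^+ 4 * D%:R :> R.
  have NB' : n%:R * #|I|%:R <= n%:R * (8839 * D%:R) :> R.
    by clear -NB; lra.
  rewrite ler_pM2l // in NB'; apply: le_trans NB' _.
  by apply: ler_wpM2r; [exact: ler0n | clear; lra].
move/le_trans; apply; apply: ler_wpM2l Dn.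
by clear; lra.
Qed.
End Numeric.

(** * Lebesgue outer volume *)

Section Volume.
Local Open Scope classical_set_scope.
Context {R : realType}.

(** A weighted cover of the unit cube by boxes has total weighted volume at
    least 1: slice along the first coordinate, apply induction to each slice
    with the weights of the boxes that meet it, and integrate over the first
    coordinate.  Passing from covers to weights is what makes the induction go
    through, and it avoids any compactness argument. *)
Lemma unit_cube_fractional_cover (d : nat) (a b : nat -> 'I_d -> R)
    (c : nat -> R) :
  (forall k, 0 <= c k) -> (forall k i, a k i <= b k i) ->
  (forall x : 'I_d -> R, (forall i, 0 <= x i <= 1) ->
    (1 <= \sum_(0 <= k <oo) (c k * \prod_i \1_(`[a k i, b k i]) (x i))%:E)%E) ->
  (1 <= \sum_(0 <= k <oo) (c k * \prod_i (b k i - a k i))%:E)%E.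
Proof.
elim: d a b c => [|d IHd] a b c c0 ab cov.
  have := cov (fun=> 0) (fun i => ltac:(by case: i)).
  congr (_ <= _)%E; apply: eq_eseriesr => k _.
  by rewrite !big_ord0.
pose v k := \prod_(i < d) (b k (lift ord0 i) - a k (lift ord0 i)).
have v0 k : 0 <= v k by apply: prodr_ge0 => i _; rewrite subr_ge0.
pose I01 : set R := `[0, 1]%classic.
pose J k : set R := `[a k ord0, b k ord0]%classic.
have slice (t : R) : 0 <= t <= 1 ->
    (1 <= \sum_(0 <= k <oo) (c k * v k)%:E * (\1_(J k) t)%:E)%E.
  move=> t01.
  have /IHd H : forall x : 'I_d -> R, (forall i, 0 <= x i <= 1) ->
      (1 <= \sum_(0 <= k <oo) (c k * \1_(J k) t *
         \prod_i \1_(`[a k (lift ord0 i), b k (lift ord0 i)]) (x i))%:E)%E.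
    move=> x x01.
    pose x' i := if unlift ord0 i is Some j then x j else t.
    have /cov : forall i, 0 <= x' i <= 1.
      by move=> i; rewrite /x'; case: unliftP => [j|] _.
    congr (_ <= _)%E; apply: eq_eseriesr => k _; congr (_%:E).
    rewrite big_ord_recl /= /x' unlift_none mulrA; congr (_ * _).
    by apply: eq_bigr => i _; rewrite liftK.
  apply: le_trans (H _ _) _ => //; first by move=> k; rewrite mulr_ge0.
  apply: lee_nneseries => k.
    by move=> _ _; rewrite lee_fin mulr_ge0 ?mulr_ge0 //; exact: v0.
  by move=> _; rewrite -EFinM lee_fin mulrAC.
have mJ k : measurable (J k) by exact: measurable_itv.
have m01 : measurable I01 by exact: measurable_itv.
have <- : (\int[lebesgue_measure]_(t in I01) (cst 1 t) = 1 :> \bar R)%E.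
  by rewrite integral_cst //= lebesgue_measure_itv /= lte_fin ltr01 oppr0 adde0 mule1.
pose f k (t : R) : \bar R := ((c k * v k)%:E * (\1_(J k) t)%:E)%E.
have mf k : measurable_fun I01 (f k).
  apply: measurable_funeM; apply/measurable_EFinP; exact: measurable_indic.
have f0 k t : (0 <= f k t)%E.
  by rewrite /f -EFinM lee_fin !mulr_ge0.
apply: (@le_trans _ _ (\int[lebesgue_measure]_(t in I01)
    \sum_(k <oo) f k t)%E).
  apply: ge0_le_integral => //.
  by apply: ge0_emeasurable_sum => [k t _ _|k _]; [exact: f0 | exact: mf].
rewrite integral_nneseries //.
apply: lee_nneseries => k; first by move=> _ _; apply: integral_ge0.
move=> _; rewrite ge0_integralZl //; last by rewrite lee_fin mulr_ge0.
  rewrite integral_indic //; last exact: mJ.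
  have -> : c k * \prod_i (b k i - a k i) = c k * v k * (b k ord0 - a k ord0).
    by rewrite big_ord_recl mulrCA mulrC.
  rewrite [leRHS]EFinM lee_wpmul2l ?lee_fin ?mulr_ge0 //.
  apply: (@le_trans _ _ (lebesgue_measure (J k))).
    by apply: le_measure; rewrite ?inE;
      [apply: measurableI; [exact: mJ | exact: m01] | exact: mJ | exact: subIsetl].
  rewrite lebesgue_measure_itv /= lte_fin; case: ifP => _.
    by rewrite -EFinB.
  by rewrite lee_fin subr_ge0.
by apply/measurable_EFinP; apply: measurable_indic; exact: mJ.
Qed.

Lemma box_volume_ge0 d (a b : 'rV[R]_d) :
  (forall i, a 0 i <= b 0 i) -> 0 <= box_volume a b.
Proof. by move=> ab; apply: prodr_ge0 => i _; rewrite subr_ge0. Qed.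

Lemma box_volume_point d (a : 'rV[R]_d) : (0 < d)%N -> box_volume a a = 0.
Proof.
move=> d0; rewrite /box_volume.
under eq_bigr => i _ do rewrite subrr.
by rewrite prodr_const card_ord expr0n gtn_eqF.
Qed.

Lemma box_series_ge0 d (a b : nat -> 'rV[R]_d) :
  (forall k i, a k 0 i <= b k 0 i) ->
  (0 <= \sum_(0 <= k <oo) (box_volume (a k) (b k))%:E)%E.
Proof.
by move=> ab; apply: nneseries_ge0 => k _ _; rewrite lee_fin box_volume_ge0.
Qed.

Lemma volume_ge0 d (A : set 'rV[R]_d) : (0 <= volume A)%E.
Proof.
apply: le_ereal_inf_tmp => _ [a [b [ab _ ->]]]; exact: box_series_ge0.
Qed.

Lemma volume_le_series d (A : set 'rV[R]_d) (a b : nat -> 'rV[R]_d) :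
  (forall k i, a k 0 i <= b k 0 i) -> A `<=` \bigcup_k box (a k) (b k) ->
  (volume A <= \sum_(0 <= k <oo) (box_volume (a k) (b k))%:E)%E.
Proof. by move=> ab Aab; apply: ereal_inf_lbound; exists a, b. Qed.

Lemma subset_volume d (A B : set 'rV[R]_d) :
  A `<=` B -> (volume A <= volume B)%E.
Proof.
move=> AB; apply: le_ereal_inf_tmp => _ [a [b [ab Bab ->]]].
by apply: volume_le_series => //; exact: subset_trans Bab.
Qed.

Lemma volume_homothetic_copy_le d (A : set 'rV[R]_d) (x : 'rV[R]_d) (r : R) :
  0 < r -> (volume (homothetic_copy x r A) <= (r ^+ d)%:E * volume A)%E.
Proof.
move=> r0; have rd0 : 0 < r ^+ d by rewrite exprn_gt0.
rewrite -lee_pdivrMl //; apply: le_ereal_inf_tmp => _ [a [b [ab Aab ->]]].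
rewrite lee_pdivrMl // -nneseriesZl; last first.
  by move=> k _; rewrite lee_fin box_volume_ge0.
apply: le_trans (volume_le_series (a := fun k => x + r *: a k)
  (b := fun k => x + r *: b k) _ _) _.
- by move=> k i; rewrite !mxE lerD2l ler_pM2l.
- move=> _ [y Ay <-]; have [k _ yk] := Aab _ Ay; exists k => // i.
  by rewrite !mxE !lerD2l !ler_pM2l.
rewrite le_eqVlt; apply/orP; left; apply/eqP; apply: eq_eseriesr => k _.
rewrite -EFinM; congr (_%:E).
transitivity (\prod_(i < d) (r * (b k 0 i - a k 0 i))).
  by apply: eq_bigr => i _; rewrite !mxE; ring.
by rewrite big_split /= prodr_const card_ord.
Qed.

Lemma volume_set0 d : (0 < d)%N -> volume (set0 : set 'rV[R]_d) = 0%E.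
Proof.
move=> d0; apply/eqP; rewrite eq_le volume_ge0 andbT.
apply: le_trans (volume_le_series (a := fun=> 0) (b := fun=> 0) _ _) _ => //.
by rewrite eseries0 // => k _ _; rewrite box_volume_point.
Qed.

(** Interleave nearly optimal covers of the two sets. *)
Lemma volumeU d (A B : set 'rV[R]_d) :
  (volume (A `|` B) <= volume A + volume B)%E.
Proof.
have [fA|] := boolP (volume A \is a fin_num); last first.
  rewrite ge0_fin_numE ?volume_ge0 // -leNgt leye_eq => /eqP ->.
  by rewrite addye ?leey // gt_eqF // (lt_le_trans _ (volume_ge0 B)).
have [fB|] := boolP (volume B \is a fin_num); last first.
  rewrite ge0_fin_numE ?volume_ge0 // -leNgt leye_eq => /eqP ->.
  by rewrite addey ?leey // gt_eqF // (lt_le_trans _ (volume_ge0 A)).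
apply/lee_addgt0Pr => e e0.
have e20 : 0 < e / 2 by rewrite divr_gt0.
have [_ [a [b [ab Aab ->]]] le_a] := lb_ereal_inf_adherent e20 fA.
have [_ [a' [b' [ab' Aab' ->]]] le_a'] := lb_ereal_inf_adherent e20 fB.
rewrite [leRHS](_ : _ = ((volume A + (e / 2)%:E) + (volume B + (e / 2)%:E))%E); last first.
  by rewrite addeACA -EFinD -splitr.
apply: le_trans (leeD (ltW le_a) (ltW le_a')).
pose mix (u v : nat -> 'rV[R]_d) k := if odd k then v k./2 else u k./2.
apply: le_trans (volume_le_series (a := mix a a') (b := mix b b') _ _) _.
- by move=> k i; rewrite /mix; case: ifP.
- move=> x [/Aab|/Aab'] [k _ xk]; [exists k.*2|exists k.*2.+1] => //.
    by rewrite /mix odd_double doubleK.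
  by rewrite /mix /= odd_double uphalf_double.
have vol0 k : (0 <= (box_volume (mix a a' k) (mix b b' k))%:E)%E.
  by rewrite lee_fin box_volume_ge0 // => i; rewrite /mix; case: ifP.
apply: lime_le; first exact: is_cvg_nneseries.
apply: nearW => n.
apply: (@le_trans _ _ (\sum_(0 <= k < n.*2)
    (box_volume (mix a a' k) (mix b b' k))%:E)%E).
  rewrite [leRHS](big_cat_nat _ (n := n)) //=; last by rewrite -addnn leq_addr.
  by rewrite leeDl // sume_ge0.
have -> : (\sum_(0 <= k < n.*2) (box_volume (mix a a' k) (mix b b' k))%:E
  = \sum_(0 <= k < n) (box_volume (a k) (b k))%:E
    + \sum_(0 <= k < n) (box_volume (a' k) (b' k))%:E)%E.
  elim: n => [|n IHn]; first by rewrite !big_geq // adde0.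
  rewrite doubleS !big_nat_recr //= IHn /mix /= odd_double /= uphalf_double doubleK.
  by rewrite addeACA addeA.
by apply: leeD; apply: nneseries_lim_ge => k _ _; rewrite lee_fin box_volume_ge0.
Qed.

Lemma volume_bigcup_seq_le d (T : choiceType) (s : seq T) (F : T -> set 'rV[R]_d)
    (v : R) : (0 < d)%N ->
  (forall t, t \in s -> (volume (F t) <= v%:E)%E) ->
  (volume (\bigcup_(t in [set` s]) F t) <= ((size s)%:R * v)%:E)%E.
Proof.
move=> d0; elim: s => [|t s IHs] Fv.
  by rewrite set_nil bigcup_set0 volume_set0 // mul0r.
have -> : [set` t :: s] = t |` [set` s].
  apply/seteqP; split=> u /=; rewrite in_cons.
    by case/predU1P => [->|us]; [left | right].
  by case=> [->|us]; rewrite ?eqxx // us orbT.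
rewrite bigcup_setU1; apply: le_trans (volumeU _ _) _.
rewrite /= -natr1 mulrDl mul1r addrC EFinD leeD ?Fv ?mem_head // IHs //.
by move=> u us; rewrite Fv // in_cons us orbT.
Qed.

Lemma volume_unit_ball_lty d : (0 < d)%N -> (volume (unit_ball R d) < +oo)%E.
Proof.
move=> d0.
pose a (k : nat) : 'rV[R]_d := if k == 0%N then const_mx (-1) else 0.
pose b (k : nat) : 'rV[R]_d := if k == 0%N then const_mx 1 else 0.
apply: le_lt_trans (volume_le_series (a := a) (b := b) _ _) _.
- by move=> [|k] i; rewrite /a /b /= !mxE //; lra.
- move=> x Bx; exists 0%N => // i; rewrite /a /b /= !mxE.
  rewrite -ler_norml -(@ler_pXn2r _ 2) ?nnegrE // expr1n real_normK ?num_real //.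
  apply: le_trans Bx; rewrite (bigD1 i) //= lerDl.
  by apply: sumr_ge0 => j _; exact: sqr_ge0.
rewrite (nneseries_split _ 1); last first.
  move=> k _; rewrite lee_fin box_volume_ge0 // => i.
  by rewrite /a /b; case: ifP => _; rewrite !mxE //; lra.
rewrite big_nat1 eseries0 ?adde0 ?ltry // => -[|k] // _ _.
by rewrite /a /b /= box_volume_point.
Qed.

(** The ball scaled by d contains the unit cube, whose outer volume is at
    least 1. *)
Lemma volume_unit_ball_gt0 d : (0 < d)%N -> (0 < volume (unit_ball R d))%E.
Proof.
move=> d0; have d0' : 0 < d%:R :> R by rewrite ltr0n.
rewrite lt_def volume_ge0 andbT; apply/eqP => vol0.
have := volume_homothetic_copy_le (unit_ball R d) 0 d0'.
rewrite vol0 mule0; apply/negP; rewrite -ltNge.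
apply: (@lt_le_trans _ _ 1%E) => //.
apply: le_ereal_inf_tmp => _ [a [b [ab Bab ->]]].
apply: le_trans (@unit_cube_fractional_cover d (fun k => a k 0)
  (fun k => b k 0) (fun=> 1) _ _ _) _ => //.
- move=> x x01.
  have [|k _ xk] := Bab (\row_i x i).
    exists (d%:R^-1 *: \row_i x i); last first.
      by rewrite add0r scalerA divff ?scale1r // gt_eqF.
    rewrite /unit_ball /=.
    apply: (@le_trans _ _ (\sum_(j < d) d%:R^-1)); last first.
      by rewrite sumr_const card_ord -[_^-1 *+ d]mulr_natl divff // gt_eqF.
    apply: ler_sum => j _; rewrite !mxE.
    have /andP[xj0 xj1] := x01 j.
    have d1 : d%:R^-1 <= 1 :> R by rewrite invf_le1 // ler1n.
    have di0 : 0 <= d%:R^-1 :> R by rewrite invr_ge0.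
    rewrite expr2; apply: (@le_trans _ _ (d%:R^-1 * 1)); last by rewrite mulr1.
    have : 0 <= d%:R^-1 * x j <= 1.
      by rewrite mulr_ge0 //= mulr_ile1.
    case/andP => ? ?.
    by apply: ler_pM => //; rewrite -[leRHS]mulr1 ler_wpM2l.
  apply: le_trans (nneseries_lim_ge k.+1 _); last first.
    by move=> l _ _; rewrite lee_fin mulr_ge0 // prodr_ge0.
  rewrite big_nat_recr //= -[leLHS]add0e leeD //.
    by apply: sume_ge0 => l _; rewrite lee_fin mulr_ge0 // prodr_ge0.
  rewrite lee_fin mul1r big1 // => i _.
  have := xk i; rewrite mxE indicE => xki.
  by rewrite mem_set.
- rewrite le_eqVlt; apply/orP; left; apply/eqP.
  by apply: eq_eseriesr => k _; rewrite mul1r.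
Qed.
End Volume.

(** * Separated points in a Euclidean ball *)

Section Geometry.
Local Open Scope classical_set_scope.
Context {R : realType}.

Definition sqnorm d (x : 'rV[R]_d) : R := \sum_(j < d) x 0 j ^+ 2.

Lemma sqnormZ d (r : R) (x : 'rV[R]_d) : sqnorm (r *: x) = r ^+ 2 * sqnorm x.
Proof.
by rewrite /sqnorm mulr_sumr; apply: eq_bigr => j _; rewrite mxE exprMn.
Qed.

(** A substitute for the triangle inequality that stays within squared norms. *)
Lemma sqnormD_le d (e : R) (x y : 'rV[R]_d) : 0 < e ->
  sqnorm (x + y) <= (1 + e) * sqnorm x + (1 + e^-1) * sqnorm y.
Proof.
move=> e0; rewrite /sqnorm !mulr_sumr -big_split; apply: ler_sum => j _ /=.
rewrite mxE -subr_ge0.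
have -> : (1 + e) * x 0 j ^+ 2 + (1 + e^-1) * y 0 j ^+ 2 - (x 0 j + y 0 j) ^+ 2
    = e * (x 0 j - e^-1 * y 0 j) ^+ 2.
  by field; rewrite gt_eqF.
by rewrite mulr_ge0 ?sqr_ge0 // ltW.
Qed.

Lemma homothetic_copy1 d (x z : 'rV[R]_d) :
  homothetic_copy x 1 (unit_ball R d) z <-> sqnorm (z - x) <= 1.
Proof.
split=> [[y By <-]|zx].
  by rewrite scale1r [x + y]addrC addrK.
by exists (z - x) => //; rewrite scale1r addrC subrK.
Qed.

(** Otherwise the midpoint of the centres lies in both balls. *)
Lemma disjoint_unit_balls d (x y : 'rV[R]_d) :
  homothetic_copy x 1 (unit_ball R d) `&` homothetic_copy y 1 (unit_ball R d)
    = set0 ->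
  4 < sqnorm (x - y).
Proof.
move=> xy0; rewrite ltNge; apply/negP => xy4.
suff : (set0 : set 'rV[R]_d) (2^-1 *: (x + y)) by [].
have half (u v : 'rV[R]_d) : 2^-1 *: (u + v) - u = 2^-1 *: (v - u).
  by apply/rowP => j; rewrite !mxE; field.
rewrite -xy0; split; apply/homothetic_copy1.
  rewrite half sqnormZ -[y - x]opprB -scaleN1r sqnormZ; lra.
by rewrite [x + y]addrC half sqnormZ; lra.
Qed.

(** A point y of the ball of squared radius rho is lifted to
    (sqrt (rho - |y|^2), y) on the sphere of dimension d.  Mutual distances do
    not decrease, so inner products are at most rho - 2, that is the fraction
    1 - 2 / rho = 0.11606 of rho; the lift is then rescaled to squared radius
    d + 1. *)
Lemma separated_points_card_le d (I : finType) (y : I -> 'rV[R]_d) :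
  4 * 10 ^+ 8 <= d.+1%:R :> R ->
  (forall i, sqnorm (y i) <= 2 + 2626 / 10 ^+ 4) ->
  (forall i j, i != j -> 4 < sqnorm (y i - y j)) ->
  #|I|%:R <= 10 ^+ 4 * (2504 / 2447) ^+ d.+1 :> R.
Proof.
move=> d_big y_le y_sep.
set rho : R := 2 + 2626 / 10 ^+ 4 in y_le.
have rho0 : 0 < rho by rewrite /rho; lra.
pose n : R := d.+1%:R.
have n0 : 0 < n by rewrite ltr0n.
pose h i := Num.sqrt (rho - sqnorm (y i)).
have hE i : h i ^+ 2 = rho - sqnorm (y i) by rewrite sqr_sqrtr // subr_ge0.
pose s := Num.sqrt (n / rho).
have sE : s ^+ 2 = n / rho by rewrite sqr_sqrtr // divr_ge0 // ltW.
pose p i (m : 'I_d.+1) : R :=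
  s * (if unlift ord0 m is Some j then y i 0 j else h i).
have pE i j : \sum_m p i m * p j m
    = n / rho * (h i * h j + \sum_m y i 0 m * y j 0 m).
  rewrite -sE big_ord_recl /p unlift_none mulrDr mulr_sumr; congr (_ + _).
    by ring.
  by apply: eq_bigr => m _; rewrite liftK; ring.
apply: (@spherical_code_exponential_bound R d.+1 I p) => // [i|i j ij].
  transitivity (\sum_m p i m * p i m); first by apply: eq_bigr => m _; rewrite expr2.
  rewrite pE -expr2 hE -/n.
  have -> : \sum_m y i 0 m * y i 0 m = sqnorm (y i).
    by apply: eq_bigr => m _; rewrite expr2.
  by rewrite subrK divfK // gt_eqF.
have -> : 1161 / 10 ^+ 4 * d.+1%:R = n / rho * (1161 / 10 ^+ 4 * rho).
  by rewrite -/n; field; rewrite gt_eqF.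
rewrite pE; apply: ler_wpM2l; first by rewrite divr_ge0 // ltW.
set t := \sum_m _.
have tE : sqnorm (y i - y j) = sqnorm (y i) + sqnorm (y j) - 2 * t.
  rewrite /sqnorm /t mulr_sumr -big_split -sumrB; apply: eq_bigr => m _ /=.
  by rewrite !mxE; ring.
have := y_sep _ _ ij; rewrite tE => sep.
have : 0 <= (h i - h j) ^+ 2 by exact: sqr_ge0.
rewrite sqrrB !hE -mulr_natl /rho; lra.
Qed.

End Geometry.

(** * Disjoint selections from a dense cluster of balls *)

Section Selection.
Local Open Scope classical_set_scope.
Context {R : realType}.

(** The balls centred at [G] cover a ball of radius [r], of volume r^d times
    that of the unit ball, whereas a disjoint selection consists of at most [N]
    unit balls. *)
Lemma selection_le_packing d (G : set 'rV[R]_d) (r c N : R) :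
  (0 < d)%N -> 0 < r -> 0 <= c -> finite_set G ->
  (forall z, sqnorm z <= r ^+ 2 -> exists2 g, G g & sqnorm (z - g) <= 1) ->
  (forall (I : finType) (y : I -> 'rV[R]_d), (forall i, G (y i)) ->
    (forall i j, i != j -> 4 < sqnorm (y i - y j)) -> #|I|%:R <= N) ->
  disjoint_selection_const (unit_ball R d) c ->
  c * r ^+ d <= N.
Proof.
move=> d0 r0 c0 finG netG packG sel.
pose ball g := homothetic_copy g 1 (unit_ball R d).
have [|S [SC Sdisj Svol]] := sel (ball @` G).
  split; first exact: finite_image.
  by exists 1; split=> // _ [g _ <-]; exists g.
have [s SE] : exists s : seq (set 'rV[R]_d), S = [set` s].
  by apply/finite_seqP; apply: sub_finite_set SC _; exact: finite_image.
have us := undup_uniq s.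
have {}SE : S = [set` undup s] by rewrite SE; apply/seteqP; split=> K /=; rewrite mem_undup.
move: (undup s) us SE => {}s us SE.
have /choice [ctr ctrP] : forall i : 'I_(size s), exists g,
    G g /\ ball g = nth set0 s i.
  move=> i.
  have /SC [g Gg <-] : S (nth set0 s i) by rewrite SE /= mem_nth.
  by exists g.
have sN : (size s)%:R <= N.
  rewrite -(card_ord (size s)); apply: (packG _ ctr) => [i|i j ij].
    by have [] := ctrP i.
  apply: disjoint_unit_balls; apply: contrapT => /eqP/set0P ne0.
  have [[_ bi] [_ bj]] := (ctrP i, ctrP j).
  move: ne0; rewrite -/(ball _) -/(ball _) bi bj => ne0.
  have Sn k : (k < size s)%N -> S (nth set0 s k) by rewrite SE /=; exact: mem_nth.
  have := Sdisj _ _ (Sn _ (ltn_ord i)) (Sn _ (ltn_ord j)) ne0 => /eqP.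
  by rewrite nth_uniq // (inj_eq val_inj) (negPf ij).
have v_fin : volume (unit_ball R d) \is a fin_num.
  by rewrite ge0_fin_numE ?volume_ge0 // volume_unit_ball_lty.
pose v := fine (volume (unit_ball R d)).
have vE : volume (unit_ball R d) = v%:E by rewrite fineK.
have v0 : 0 < v by rewrite -lte_fin -vE volume_unit_ball_gt0.
have upper : (volume (\bigcup_(K in S) K) <= ((size s)%:R * v)%:E)%E.
  rewrite SE; apply: volume_bigcup_seq_le => // K Ks.
  have /SC [g _ <-] : S K by rewrite SE.
  apply: le_trans (volume_homothetic_copy_le _ _ ltr01) _.
  by rewrite expr1n mul1e vE.
have lower : ((r ^+ d * v)%:E <= volume (\bigcup_(K in ball @` G) K))%E.
  have rd0 : 0 < r ^+ d by rewrite exprn_gt0.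
  apply: le_trans (subset_volume (A := homothetic_copy 0 r (unit_ball R d)) _).
    rewrite EFinM -lee_pdivlMl // -vE.
    have r'0 : 0 < r^-1 by rewrite invr_gt0.
    have := volume_homothetic_copy_le
      (homothetic_copy 0 r (unit_ball R d)) 0 r'0.
    rewrite exprVn; apply: le_trans; apply: subset_volume => x Bx.
    exists (r *: x); last by rewrite add0r scalerA mulVf ?scale1r // gt_eqF.
    by exists x => //; rewrite add0r.
  move=> _ [x Bx <-]; rewrite add0r.
  have [|g Gg zg] := netG (r *: x).
    by rewrite sqnormZ -[leRHS]mulr1 ler_wpM2l // sqr_ge0.
  by exists (ball g); [exists g | apply/homothetic_copy1].
have : ((c * (r ^+ d * v))%:E <= ((size s)%:R * v)%:E)%E.
  by apply: le_trans (le_trans _ Svol) upper; rewrite EFinM lee_wpmul2l.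
rewrite lee_fin mulrA ler_pM2r // => crd.
exact: le_trans sN.
Qed.

(** A point z of norm at most 2.504 is first contracted to z' = 0.60068 z, so
    that |z'| < 1.5042 and |z - z'| < 0.9999, and z' is then rounded to a cubic
    grid of mesh 10^-5 / d.  The rounding error is at most 10^-5 in norm and
    fits into the slack of both estimates. *)
Lemma finite_net_of_ball d : (0 < d)%N -> exists G : set 'rV[R]_d,
  [/\ finite_set G, forall g, G g -> sqnorm g <= 2 + 2626 / 10 ^+ 4
    & forall z, sqnorm z <= (2504 / 10 ^+ 3) ^+ 2 ->
        exists2 g, G g & sqnorm (z - g) <= 1].
Proof.
move=> d0; have dR0 : 0 < d%:R :> R by rewrite ltr0n.
pose e : R := 10 ^- 5.
have e0 : 0 < e by rewrite invr_gt0 exprn_gt0.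
pose h : R := e / d%:R.
have h0 : 0 < h by rewrite divr_gt0.
pose M := (Num.truncn (4 / h)).+1.
pose pt (f : {ffun 'I_d -> 'I_M}) : 'rV[R]_d := \row_j (h * (f j)%:R - 2).
exists [set g | sqnorm g <= 2 + 2626 / 10 ^+ 4 /\ g \in codom pt]; split.
- by apply: (@sub_finite_set _ _ [set` codom pt]) => // g [].
- by move=> g [].
move=> z z_le.
pose a : R := 6 / 10 + 68 / 10 ^+ 5.
pose z' := a *: z.
have z'_le : sqnorm z' <= 2 + 2624 / 10 ^+ 4.
  rewrite sqnormZ; apply: le_trans (ler_wpM2l (sqr_ge0 _) z_le) _.
  by rewrite /a; lra.
have zz'_le : sqnorm (z - z') <= 1 - 2 / 10 ^+ 4.
  have -> : z - z' = (1 - a) *: z by rewrite scalerBl scale1r.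
  rewrite sqnormZ; apply: le_trans (ler_wpM2l (sqr_ge0 _) z_le) _.
  by rewrite /a; lra.
have z'_range j : -2 <= z' 0 j <= 2.
  rewrite -ler_norml -(@ler_pXn2r _ 2) ?nnegrE // real_normK ?num_real //.
  apply: le_trans (_ : sqnorm z' <= _); last by lra.
  rewrite /sqnorm (bigD1 j) //= lerDl.
  by apply: sumr_ge0 => i _; exact: sqr_ge0.
pose q j := (z' 0 j + 2) / h.
have q0 j : 0 <= q j.
  by have /andP[? _] := z'_range j; rewrite divr_ge0 ?(ltW h0) //; lra.
have qM j : (Num.truncn (q j) < M)%N.
  rewrite ltnS truncn_ge_nat; last by rewrite divr_ge0 // ltW.
  have /andP[qt _] := truncn_itv (q0 j); apply: le_trans qt _.
  have /andP[_ ?] := z'_range j.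
  by rewrite ler_pM2r ?invr_gt0 //; lra.
pose g := pt [ffun j => Ordinal (qM j)].
have z'g : sqnorm (z' - g) <= e ^+ 2.
  apply: (@le_trans _ _ (\sum_(j < d) e ^+ 2 / d%:R)); last first.
    by rewrite sumr_const card_ord -[_ *+ d]mulr_natr divfK // gt_eqF.
  apply: ler_sum => j _.
  have /andP[qt tq] := truncn_itv (q0 j).
  have qh : q j * h = z' 0 j + 2 by rewrite divfK // gt_eqF.
  have gE : g 0 j = h * (Num.truncn (q j))%:R - 2 by rewrite !mxE ffunE.
  have z'gE : (z' - g) 0 j = z' 0 j - g 0 j by rewrite !mxE.
  apply: (@le_trans _ _ (h ^+ 2)).
    have -> : (z' - g) 0 j = h * (q j - (Num.truncn (q j))%:R).
      by rewrite z'gE gE mulrBr [h * q j]mulrC qh; ring.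
    rewrite exprMn ger_pMr ?exprn_gt0 // exprn_ile1 //; first by rewrite subr_ge0.
    by move: tq; rewrite -natr1; lra.
  rewrite /h exprMn ler_pM2l ?exprn_gt0 // expr2 -[leRHS]mulr1.
  by rewrite ler_pM2l ?invr_gt0 // invf_le1 // ler1n.
have gz' : sqnorm (g - z') <= e ^+ 2.
  by rewrite -opprB -scaleN1r sqnormZ sqrrN expr1n mul1r.
have eE : (1 + e^-1) * e ^+ 2 = e ^+ 2 + e by field; rewrite gt_eqF.
have e_le : e ^+ 2 + e <= 2 / 10 ^+ 5 by rewrite /e; lra.
have e'0 : 0 <= 1 + e^-1 by rewrite addr_ge0 // invr_ge0 ltW.
exists g.
  split; last by apply: codom_f.
  have -> : g = z' + (g - z') by rewrite addrC subrK.
  apply: le_trans (sqnormD_le _ _ e0) _.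
  have ez' : e * sqnorm z' <= 3 * e by rewrite mulrC ler_pM2r //; lra.
  have := ler_wpM2l e'0 gz'; rewrite eE; move: z'_le ez' e_le; rewrite /e; lra.
have -> : z - g = (z - z') + (z' - g) by rewrite addrA subrK.
apply: le_trans (sqnormD_le _ _ e0) _.
have ez : e * sqnorm (z - z') <= e by rewrite ger_pMr //; lra.
have := ler_wpM2l e'0 z'g; rewrite eE; move: zz'_le ez e_le; rewrite /e; lra.
Qed.
End Selection.

(** A single ball is a selection problem of its own. *)
Lemma selection_le1 (R : realType) d (c : R) : (0 < d)%N -> 0 <= c ->
  disjoint_selection_const (unit_ball R d) c -> c <= 1.
Proof.
move=> d0 c0 sel; suff : c * 1 ^+ d <= 1 by rewrite expr1n mulr1.
apply: (selection_le_packing (G := [set 0]%classic) _ _ _ _ _ _ sel) => //.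
- by move=> z; rewrite expr1n => z1; exists 0; rewrite ?subr0.
move=> I y y0 y_sep; rewrite lern1; apply/card_le1_eqP => i j _ _.
apply/eqP/negP => /negP ij; have := y_sep _ _ ij.
have [-> ->] := (y0 i, y0 j); rewrite subrr /sqnorm big1 ?ltrn0 // => m _.
by rewrite mxE expr0n.
Qed.

Lemma selection_le_large_dim (R : realType) d (c : R) :
  4 * 10 ^+ 8 <= d.+1%:R :> R -> 0 <= c ->
  disjoint_selection_const (unit_ball R d) c ->
  c * (2504 / 10 ^+ 3) ^+ d <= 10 ^+ 4 * (2504 / 2447) ^+ d.+1.
Proof.
move=> d_big c0 sel.
have d0 : (0 < d)%N by case: d d_big {sel} => //; lra.
have [G [finG G_le netG]] := finite_net_of_ball (R := R) d0.
apply: (selection_le_packing d0 _ c0 finG netG _ sel); first by clear; lra.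
move=> I y Gy y_sep; apply: separated_points_card_le d_big _ y_sep => i.
exact: G_le.
Qed.

Unset Implicit Arguments.
Set Strict Implicit.
Set Printing Implicit Defensive.

Theorem theorem6p1 (R : realType) :
  exists C : R, 0 < C /\
    forall d : nat, (1 <= d)%N ->
      (selection_const (unit_ball R d) <= (C * (2447 / 1000) ^- d)%:E)%E.
Proof.
pose n0 := Num.bound (4 * 10 ^+ 8 : R).
pose b : R := 2447 / 1000.
have b1 : 1 <= b by rewrite /b; lra.
have b0 : 0 < b by apply: lt_le_trans b1.
have bn0 : 0 < b ^+ n0 by rewrite exprn_gt0.
exists (2 * 10 ^+ 4 + b ^+ n0); split; first by rewrite addr_gt0 // mulr_gt0 ?exprn_gt0.
move=> d d0; rewrite -/b; apply: ge_ereal_sup => _ [c [c0 sel] <-].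
rewrite lee_fin ler_pdivlMr ?exprn_gt0 //.
(* In the remaining small dimensions the constant absorbs the trivial bound 1. *)
have [small|large] := ltP d.+1%:R (4 * 10 ^+ 8 : R).
  have dn0 : (d <= n0)%N.
    rewrite -(ler_nat R); apply: ltW.
    apply: lt_trans (archi_boundP _); last by rewrite mulr_ge0 ?exprn_ge0.
    by apply: lt_trans small; rewrite ltr_nat.
  apply: (@le_trans _ _ (1 * b ^+ n0)).
    apply: ler_pM => //; first by exact: exprn_ge0 (ltW b0).
      exact: selection_le1 d0 c0 sel.
    exact: ler_weXn2l.
  by rewrite mul1r lerDr mulr_ge0 ?exprn_ge0.
apply: (@le_trans _ _ (2 * 10 ^+ 4)); last by rewrite lerDl ltW.
have := selection_le_large_dim large c0 sel.
set a : R := 2504 / 10 ^+ 3.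
have -> : 2504 / 2447 = a / b :> R by rewrite /a /b; field.
have a0 : 0 < a by rewrite /a; clear; lra.
have ab : a / b <= 2 by rewrite /a /b; clear; lra.
rewrite (exprS (a / b)) (expr_div_n a b); clearbody a b => H.
have ad0 : 0 < a ^+ d / b ^+ d by apply: divr_gt0; exact: exprn_gt0.
rewrite -(ler_pM2r ad0).
have -> : c * b ^+ d * (a ^+ d / b ^+ d) = c * a ^+ d.
  by field; rewrite gt_eqF // exprn_gt0.
apply: le_trans H _; rewrite [leLHS]mulrA; apply: ler_wpM2r; first exact: ltW.
by rewrite [leRHS]mulrC; apply: ler_wpM2l ab; exact: exprn_ge0.
Qed.
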